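(* For every integer $a>24$, $R_2(2x+2y+az=(a+3)w)=10$, where $x,y,z,w$ are the variables of the equation.
   Context: For a positive integer $N$ let $[N]=\{1,\dots,N\}$. For a linear homogeneous equation $\mathcal{E}$ with integer coefficients and a positive integer $c$, the Rado number $R_c(\mathcal{E})$ is the least positive integer $N$ such that every $c$-coloring of $[N]$ contains a monochromatic solution to $\mathcal{E}$, i.e. a solution whose variables all take values in $[N]$ (not necessarily distinct) having the same color. If no such $N$ exists, $R_c(\mathcal{E})=\infty$. *)

(* Defs.v *)
From mathcomp Require Import all_boot all_order all_algebra.
From mathcomp Require Import boolp.

Set Implicit Arguments.
Unset Strict Implicit.
Unset Printing Implicit Defensive.

Import Order.TTheory GRing.Theory Num.Theory.
Local Open Scope ring_scope.

(* A linear homogeneous equation in k variables, encoded by its coefficients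
   once all terms are moved to the left-hand side. An assignment of values in
   [N] = {1, ..., N} is x : {ffun 'I_k -> 'I_N}, where i : 'I_N stands for
   i.+1. *)
Definition is_solution (k N : nat) (E : k.-tuple int)
    (x : {ffun 'I_k -> 'I_N}) : bool :=
  \sum_(i < k) tnth E i * (x i).+1%:Z == 0.

Definition monochromatic (k N c : nat) (chi : {ffun 'I_N -> 'I_c})
    (x : {ffun 'I_k -> 'I_N}) : bool :=
  [forall i, forall j, chi (x i) == chi (x j)].

Definition forces_solution (k c : nat) (E : k.-tuple int) (N : nat) : bool :=
  [forall chi : {ffun 'I_N -> 'I_c}, exists x : {ffun 'I_k -> 'I_N},
     is_solution E x && monochromatic chi x].

(* None stands for an infinite Rado number. *)
Definition rado_number (k c : nat) (E : k.-tuple int) : option nat :=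
  if pselect (exists N, (0 < N)%N && forces_solution c E N) is left exN
  then Some (ex_minn exN) else None.

(* 2 x + 2 y + a z = (a + 3) w, with the variables in the order x, y, z, w. *)
Definition eq_2_2_a (a : int) : 4.-tuple int :=
  [tuple 2; 2; a; - (a + 3)].

Lemma is_solution_eq_2_2_a (a : int) (N : nat) (x y z w : 'I_N) :
  is_solution (eq_2_2_a a) [ffun i => tnth [tuple x; y; z; w] i] =
  (2 * x.+1%:Z + 2 * y.+1%:Z + a * z.+1%:Z == (a + 3) * w.+1%:Z).
Proof.
rewrite /is_solution !big_ord_recr big_ord0 /= !ffunE !(tnth_nth 0) /=.
by rewrite !(tnth_nth x) /= add0r mulNr subr_eq0.
Qed.

(* Main.v *)
(* The equation reads a (w - z) = 2 (x + y) - 3 w.  When z = w the parameter a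
   disappears, and the solutions of 2 (x + y) = 3 w in [10] already rule out
   every 2-coloring.  In [9], a > 24 leaves few solutions with z <> w, and the
   coloring with classes {2, 3, 5, 8} and {1, 4, 6, 7, 9} avoids those too. *)
Require Import Defs.
From mathcomp Require Import all_boot all_order all_algebra.
From mathcomp Require Import boolp zify.

Lemma forces_solution_leq (k c : nat) (E : k.-tuple int) (M N : nat) :
  M <= N -> forces_solution c E M -> forces_solution c E N.
Proof.
move=> leMN /forallP forcesM; apply/forallP => chi.
have /existsP[x /andP[solx monox]] :=
  forcesM [ffun i => chi (widen_ord leMN i)].
apply/existsP; exists [ffun i => widen_ord leMN (x i)]; apply/andP; split.
  by rewrite /is_solution; under eq_bigr do rewrite ffunE /=.
apply/forallP => i; apply/forallP => j.
by have /forallP/(_ i)/forallP/(_ j) := monox; rewrite !ffunE.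
Qed.

(** Forcing passes from an interval to any longer one, so two consecutive lengths locate the
    minimum. The guard [0 < N] is there because the minimum ranges over positive lengths only. *)
Lemma rado_numberE (k c : nat) (E : k.-tuple int) (N : nat) :
  forces_solution c E N.+1 -> (0 < N -> ~~ forces_solution c E N) ->
  rado_number c E = Some N.+1.
Proof.
move=> forcesSN avoidN; rewrite /rado_number; case: pselect => [exN|[]]; last first.
  by exists N.+1.
congr Some; case: ex_minnP => m /andP[m_gt0 forcesm] minm.
apply/eqP; rewrite eqn_leq minm //= ltnNge; apply/negP => lemN.
have /avoidN/negP[] : 0 < N by exact: leq_trans lemN.
exact: forces_solution_leq lemN forcesm.
Qed.

Lemma monochromatic_solutionP (a : int) (N c : nat)
    (chi : {ffun 'I_N -> 'I_c}) :
  reflect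
    (exists x y z w : 'I_N,
      [/\ (2 * x.+1%:Z + 2 * y.+1%:Z + a * z.+1%:Z = (a + 3) * w.+1%:Z)%R,
          chi x = chi w, chi y = chi w & chi z = chi w])
    [exists x, is_solution (eq_2_2_a a) x && monochromatic chi x].
Proof.
apply: (iffP existsP) => [[v /andP[solv monov]]|[x [y [z [w [sol xw yw zw]]]]]].
  pose o k := v (inord k : 'I_4).
  have vE : v = [ffun i => tnth [tuple o 0; o 1; o 2; o 3] i].
    apply/ffunP => i; rewrite ffunE (tnth_nth (v i)) -[in LHS](inord_val i).
    by case: i => [[|[|[|[|]]]] ?].
  exists (o 0), (o 1), (o 2), (o 3); split.
  - by apply/eqP; rewrite -is_solution_eq_2_2_a -vE.
  - by apply/eqP; have /forallP/(_ (inord 0))/forallP := monov; apply.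
  - by apply/eqP; have /forallP/(_ (inord 1))/forallP := monov; apply.
  - by apply/eqP; have /forallP/(_ (inord 2))/forallP := monov; apply.
exists [ffun i => tnth [tuple x; y; z; w] i]; apply/andP; split.
  by rewrite is_solution_eq_2_2_a; apply/eqP.
have colorE i : chi (tnth [tuple x; y; z; w] i) = chi w.
  by rewrite (tnth_nth x); case: i => [[|[|[|[|]]]] ?].
by apply/forallP => i; apply/forallP => j; rewrite !ffunE !colorE.
Qed.

Lemma forces_solution_10 (a : int) : forces_solution 2 (eq_2_2_a a) 10.
Proof.
apply/forallP => chi; apply: contraT => /monochromatic_solutionP avoid.
(* [f] is indexed by the actual integers 1 to 10, hence the shift by one. *)
pose f n := chi (inord n.-1) == ord0.
have sol x y w :
    [&& 0 < x <= 10, 0 < y <= 10, 0 < w <= 10 & 2 * (x + y) == 3 * w] ->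
    ~~ ((f x == f w) && (f y == f w)).
  move=> /and4P[x10 y10 w10 /eqP xyw]; apply/negP => /andP[/eqP fxw /eqP fyw].
  (* With only two colors, the test against [ord0] determines the color. *)
  have chiE m n : f m = f n -> chi (inord m.-1) = chi (inord n.-1).
    rewrite /f; case: (chi _) (chi _) => [[|[|?]] ?] [[|[|?]] ?] // _.
      exact: val_inj.
    exact: val_inj.
  case: avoid.
  exists (inord x.-1), (inord y.-1), (inord w.-1), (inord w.-1).
  split; rewrite ?(chiE _ _ fxw) ?(chiE _ _ fyw) //.
  by rewrite !inordK; lia.
(* The first three triples put 1, 4 in one class and 2, 8 in the other. The next ones then force 3
   to join 2, 6 to join 1, 5 to join 2, 10 to join 1 and 9 to join 2, so that 3, 9, 8 is
   monochromatic. The color of 7 is never consulted. *)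
move: (sol 1 2 2 isT) (sol 2 4 4 isT) (sol 4 8 8 isT) (sol 3 3 4 isT)
  (sol 6 6 8 isT) (sol 1 5 4 isT) (sol 5 10 10 isT) (sol 6 9 10 isT)
  (sol 3 9 8 isT).
by case: (f 1) (f 2) (f 3) (f 4) (f 5) (f 6) (f 8) (f 9) (f 10) =>
  [] [] [] [] [] [] [] [] [].
Qed.

Definition color9 (n : nat) : bool := n \in [:: 2; 3; 5; 8].

(* For z <> w, only the bound |a (w - z)| >= 25 |w - z| is used, so that one
   finite check covers all a > 24. *)
Lemma color9_check :
  let r := iota 1 9 in
  all (fun x => all (fun y => all (fun z => all (fun w =>
    [&& color9 x == color9 w, color9 y == color9 w & color9 z == color9 w] ==>
    ~~ (if z == w then 2 * (x + y) == 3 * w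
        else if z < w then 25 * (w - z) + 3 * w <= 2 * (x + y)
        else 2 * (x + y) + 25 * (z - w) <= 3 * w))
    r) r) r) r.
Proof. by vm_compute. Qed.

Lemma avoids_solution_9 (a : int) :
  (24 < a)%R -> ~~ forces_solution 2 (eq_2_2_a a) 9.
Proof.
move=> a_gt24; apply/forallPn.
exists [ffun i : 'I_9 => inord (color9 i.+1)].
apply/monochromatic_solutionP => -[x [y [z [w [sol]]]]]; rewrite !ffunE.
have colorE (b1 b2 : bool) : inord b1 = inord b2 :> 'I_2 -> b1 = b2.
  by move=> /(congr1 val) /=; rewrite !inordK; case: b1 b2 => [] [].
move=> /colorE xw /colorE yw /colorE zw.
have in9 (i : 'I_9) : i.+1 \in iota 1 9 by rewrite mem_iota; case: i.
have /allP/(_ _ (in9 x))/allP/(_ _ (in9 y)) := color9_check.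
move=> /allP/(_ _ (in9 z))/allP/(_ _ (in9 w)).
rewrite xw yw zw !eqxx /= => /negP; apply.
(* If z = w, the terms in [a] cancel. Otherwise the sign of w - z decides on which side [a] is
   bounded below by 25, and in each branch the truncated subtraction of the check is exact. *)
case: eqP => [[zwE]|zwN]; first by apply/eqP; move: sol; rewrite zwE; nia.
by case: ifP => ltzw; nia.
Qed.

Theorem theorem3p9 (a : int) (ha : (24 < a)%R) :
  rado_number 2 (eq_2_2_a a) = Some 10.
Proof.
apply: rado_numberE => [|_]; first exact: forces_solution_10.
exact: avoids_solution_9.
Qed.
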